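(* Let $m\ge0$ and let $\mathbf X^m\in\mathbb X_p^h$ be given. Assume that: (i) at least two vectors in $\{\widetilde{\mathbf h}_j^m\}_{j=1}^{N-1}$ are not parallel, i.e. there exist $1\le j_1<j_2\le N-1$ such that $\widetilde{\mathbf h}_{j_1}^m\cdot(\widetilde{\mathbf h}_{j_2}^m)^\perp\ne0$, where $\widetilde{\mathbf h}_j^m=\mathbf X^m(\rho_{j+1})-\mathbf X^m(\rho_{j-1})$ for $1\le j\le N-2$ and $\widetilde{\mathbf h}_{N-1}^m=\mathbf X^m(\rho_{N-1})-\mathbf X^m(\rho_1)$; (ii) there is no degenerate edge: $\min_{1\le j\le N}|\mathbf h_j^m|>0$, where $\mathbf h_j^m=\mathbf X^m(\rho_j)-\mathbf X^m(\rho_{j-1})$. Then the full discretization is well-posed, i.e. there exists a unique $(\mathbf X^{m+1},\mu^{m+1})\in\mathbb X_p^h\times\mathbb K_p^h$ such that $$\Big(\frac{\mathbf X^{m+1}-\mathbf X^m}{\tau},\varphi^h\mathbf n^m\Big)^h_{\Gamma^m}+\big(\partial_s\mu^{m+1},\partial_s\varphi^h\big)^h_{\Gamma^m}=0\quad\forall\varphi^h\in\mathbb K_p^h,$$ $$\big(\mu^{m+1},\mathbf n^m\cdot\boldsymbol\omega^h\big)^h_{\Gamma^m}-\big(G(\theta^m)\partial_s\mathbf X^{m+1},\partial_s\boldsymbol\omega^h\big)^h_{\Gamma^m}=0\quad\forall\boldsymbol\omega^h\in\mathbb X_p^h.$$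
   Context: The surface energy $\gamma\in C^1([-\pi,\pi])$ is positive with $\gamma(-\pi)=\gamma(\pi)$. $G(\theta)=\begin{pmatrix}\gamma(\theta)&-\gamma'(\theta)\\ \gamma'(\theta)&\gamma(\theta)\end{pmatrix}$. For $\mathbf v=(v_1,v_2)^T$, $\mathbf v^\perp=(v_2,-v_1)^T$. Let $N\ge3$ be an integer, $\tau>0$ the time step, $h=1/N$, $\rho_j=jh$ ($0\le j\le N$), $I_j=[\rho_{j-1},\rho_j]$. $\mathbb K_p^h$ is the space of continuous functions $u^h$ on $[0,1]$ which are affine on each $I_j$ and satisfy $u^h(0)=u^h(1)$; $\mathbb X_p^h=\mathbb K_p^h\times\mathbb K_p^h$. With $\mathbf h_j^m=(h^m_{j,x},h^m_{j,y})^T$: the normal $\mathbf n^m$ is constant on $I_j$ with value $-(\mathbf h_j^m)^\perp/|\mathbf h_j^m|$, and $\theta^m|_{I_j}=\theta_j^m\in[-\pi,\pi]$ satisfies $\cos\theta_j^m=h^m_{j,x}/|\mathbf h_j^m|$, $\sin\theta_j^m=h^m_{j,y}/|\mathbf h_j^m|$. On $\Gamma^m$, for $f$ affine on each $I_j$ (including $f=\mathbf X^{m+1}$), $\partial_s f|_{I_j}=\big(f(\rho_j)-f(\rho_{j-1})\big)/|\mathbf h_j^m|$. The mass-lumped inner product is $(u,v)^h_{\Gamma^m}=\frac12\sum_{j=1}^N|\mathbf h_j^m|\big[(u\cdot v)(\rho_j^-)+(u\cdot v)(\rho_{j-1}^+)\big]$, with one-sided limits at the nodes. *)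

(* Defs.v *)
(* MathComp / MathComp-Analysis, over an arbitrary [R : realType]. *)
From HB Require Import structures.
From mathcomp Require Import all_boot all_order all_algebra.
From mathcomp Require Import all_classical all_reals all_analysis.
Set Implicit Arguments.
Unset Strict Implicit.
Unset Printing Implicit Defensive.
Import Order.TTheory GRing.Theory Num.Theory.
Import numFieldNormedType.Exports.
Local Open Scope classical_set_scope.
Local Open Scope ring_scope.

(** Plane vectors *)

Definition dot (R : realType) (u v : 'cV[R]_2) : R := \sum_i u i 0 * v i 0.

(* The norm `|v| that the library puts on matrices is the sup norm, so the
   Euclidean norm is defined separately. *)
Definition enorm (R : realType) (v : 'cV[R]_2) : R := Num.sqrt (dot v v).

Definition perp (R : realType) (v : 'cV[R]_2) : 'cV[R]_2 :=
  \col_(i < 2) [:: v 1 0; - v 0 0]`_i.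

(** Surface energy *)

(* The derivative relative to [a, b]: two-sided inside, one-sided at the
   endpoints.  Values of f outside [a, b] are irrelevant. *)
Definition diff_quot (R : realType) (f : R -> R) (x y : R) : R :=
  (f y - f x) / (y - x).

Definition derive_on (R : realType) (a b : R) (f : R -> R) (x : R) : R :=
  lim (diff_quot f x y @[y --> within `[a, b] x^']).

Definition C1_on (R : realType) (a b : R) (f : R -> R) : Prop :=
  {in `[a, b], forall x, cvg (diff_quot f x y @[y --> within `[a, b] x^'])} /\
  {within `[a, b], continuous (derive_on a b f)}.

Definition Gmat (R : realType) (gamma : R -> R) (theta : R) : 'M[R]_2 :=
  let g := gamma theta in
  let dg := derive_on (- pi) pi gamma theta in
  \matrix_(i < 2, j < 2) (nth [::] [:: [:: g; - dg]; [:: dg; g]] i)`_j.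

(** Mesh and finite element spaces *)

Definition rho (R : realType) (N j : nat) : R := j%:R * (1 / N%:R).

(* Elements of the spaces are total functions on R of which only the
   restriction to [0, 1] matters; they are compared on [0, 1] only. *)
Definition Kph (R : realType) (N : nat) (u : R -> R) : Prop :=
  [/\ {within `[0, 1], continuous u},
      forall j : nat, (1 <= j <= N)%N ->
        exists a b : R, {in `[rho R N j.-1, rho R N j], forall x, u x = a + b * x}
    & u 0 = u 1].

Definition Xph (R : realType) (N : nat) (X : R -> 'cV[R]_2) : Prop :=
  forall i : 'I_2, Kph N (fun x => X x i 0).

(* The function equal to c j on the interior of I_j = [rho (j-1), rho j].
   Its values at the nodes are never used: the lumped inner product only takes
   one-sided limits. *)
Definition piecewise (R : realType) (V : nmodType) (N : nat) (c : nat -> V)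
    (x : R) : V :=
  \sum_(1 <= j < N.+1 | rho R N j.-1 < x < rho R N j) c j.

(** The polygonal curve parametrized by X *)

Definition edge (R : realType) (N : nat) (X : R -> 'cV[R]_2) (j : nat) :
    'cV[R]_2 :=
  X (rho R N j) - X (rho R N j.-1).

Definition tilde_edge (R : realType) (N : nat) (X : R -> 'cV[R]_2) (j : nat) :
    'cV[R]_2 :=
  if (j <= N - 2)%N then X (rho R N j.+1) - X (rho R N j.-1)
  else X (rho R N N.-1) - X (rho R N 1).

Definition normal (R : realType) (N : nat) (X : R -> 'cV[R]_2) :
    R -> 'cV[R]_2 :=
  piecewise N (fun j => - ((enorm (edge N X j))^-1 *: perp (edge N X j))).

Definition is_edge_angle (R : realType) (N : nat) (X : R -> 'cV[R]_2)
    (theta : nat -> R) : Prop :=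
  forall j : nat, (1 <= j <= N)%N ->
    [/\ - pi <= theta j <= pi,
        cos (theta j) = edge N X j 0 0 / enorm (edge N X j)
      & sin (theta j) = edge N X j 1 0 / enorm (edge N X j)].

Definition ds (R : realType) (V : lmodType R) (N : nat) (X : R -> 'cV[R]_2)
    (f : R -> V) : R -> V :=
  piecewise N (fun j =>
    (enorm (edge N X j))^-1 *: (f (rho R N j) - f (rho R N j.-1))).

(* The mass-lumped inner product depends on its arguments only through their
   pointwise product w. *)
Definition lumped (R : realType) (N : nat) (X : R -> 'cV[R]_2) (w : R -> R) : R :=
  2^-1 * \sum_(1 <= j < N.+1) enorm (edge N X j) *
    (lim (w x @[x --> (rho R N j)^'-]) + lim (w x @[x --> (rho R N j.-1)^'+])).

Definition ip_scal (R : realType) (N : nat) (X : R -> 'cV[R]_2) (u v : R -> R) : R :=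
  lumped N X (fun x => u x * v x).

Definition ip_vec (R : realType) (N : nat) (X : R -> 'cV[R]_2)
    (u v : R -> 'cV[R]_2) : R :=
  lumped N X (fun x => dot (u x) (v x)).

(** The full discretization; X is the current curve, theta its edge angles and
    (Y, mu) the unknown at the next time step. *)

Definition is_solution (R : realType) (gamma : R -> R) (N : nat) (tau : R)
    (X : R -> 'cV[R]_2) (theta : nat -> R) (Y : R -> 'cV[R]_2) (mu : R -> R) :
    Prop :=
  [/\ Xph N Y,
      Kph N mu,
      forall phi : R -> R, Kph N phi ->
        ip_vec N X (fun x => tau^-1 *: (Y x - X x)) (fun x => phi x *: normal N X x)
        + ip_scal N X (ds (V := R^o) N X mu) (ds (V := R^o) N X phi) = 0
    & forall omega : R -> 'cV[R]_2, Xph N omega ->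
        ip_scal N X mu (fun x => dot (normal N X x) (omega x))
        - ip_vec N X (fun x => Gmat gamma (piecewise N theta x) *m ds N X Y x)
            (ds N X omega) = 0].

(* Main.v *)
From HB Require Import structures.
Require Import Defs.
From mathcomp Require Import all_boot all_order all_algebra.
From mathcomp Require Import all_classical all_reals all_analysis.
From mathcomp Require Import ring lra.
Import Order.TTheory GRing.Theory Num.Theory.
Import numFieldNormedType.Exports.
Local Open Scope classical_set_scope.
Local Open Scope ring_scope.
Set Implicit Arguments.
Unset Strict Implicit.
Unset Printing Implicit Defensive.

(** Both unknowns are determined by their values at the N nodes of a cyclic
mesh, so the scheme is a square linear system and well-posedness amounts to
uniqueness for the homogeneous system.  Adding its two equations gives one
bilinear form on pairs (Y, mu), called [saddle] below.

Uniqueness comes from an energy identity.  Testing the homogeneous system with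
(-Y, tau mu) makes the two coupling terms cancel and leaves

  tau (ds mu, ds mu) + (G ds Y, ds Y) = 0.

The skew part of G drops out of its quadratic form, so (G v) . v = gamma |v|^2,
and both terms vanish: mu and Y are constant.  What is left of the system says,
for each node, that the constant vector Y is orthogonal to the sum of the
weighted normals of the two edges meeting there, and that mu times that sum is
zero.  Rotated by a right angle, that sum is the chord joining the two
neighbours of the node, up to sign ([tilde_edge_weight]).  Two of these chords
are not parallel, so Y = 0 and mu = 0 ([saddle_nondegenerate]).

The passage between the scheme and its nodal form ([is_solution_nodal]) computes
the one-sided limits in the lumped products from the fact that every factor is
affine on each edge, and uses hat functions to realize arbitrary nodal values
by elements of the finite element spaces. *)

(** * Linear systems given by a bilinear form *)

(** The map sending w to the coordinates of [B w] in the dual of a basis of W is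
an injective endomorphism of a finite dimensional space, hence onto. *)
Lemma nondegenerate_form_solvable (K : fieldType) (W : vectType K)
    (B : W -> W -> K) (f : W -> K) :
  (forall z, linear_for *%R (B ^~ z)) -> (forall w, linear_for *%R (B w)) ->
  linear_for *%R f ->
  (forall w, (forall z, B w z = 0) -> w = 0) ->
  exists w, forall z, B w z = f z.
Proof.
move=> Bl Br flin Binj.
pose lr (g : W -> K) (h : linear_for *%R g) : {linear W -> K | *%R} :=
  HB.pack g (GRing.isLinear.Build K W K *%R g h).
(* A linear form is determined by its values on the basis; [repr] stores these
   values as coordinates, so that it takes values in W itself. *)
have expand g (h : linear_for *%R g) z : g z =
    \sum_(i < \dim {:W}) coord (vbasis {:W}) i z * g (vbasis {:W})`_i.
  have := linear_sum (lr g h) (index_enum 'I_(\dim {:W})) xpredT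
            (fun i => coord (vbasis {:W}) i z *: (vbasis {:W})`_i).
  rewrite -coord_vbasis ?memvf // => /= ->.
  by apply: eq_bigr => i _; have := linearZ_LR (lr g h) _ _ => /= ->.
pose repr (g : W -> K) : W :=
  \sum_(i < \dim {:W}) g (vbasis {:W})`_i *: (vbasis {:W})`_i.
have repr_inj g1 g2 : linear_for *%R g1 -> linear_for *%R g2 ->
    repr g1 = repr g2 -> forall z, g1 z = g2 z.
  move=> h1 h2 e z; rewrite (expand _ h1) (expand _ h2); apply: eq_bigr => i _.
  have := congr1 (coord (vbasis {:W}) i) e.
  by rewrite !coord_sum_free ?(basis_free (vbasisP _)) // => ->.
have Llin : linear (fun w => repr (B w)).
  move=> a u v; rewrite /repr scaler_sumr -big_split /=; apply: eq_bigr => i _.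
  by rewrite Bl scalerDl scalerA.
pose L : {linear W -> W} :=
  HB.pack (fun w => repr (B w)) (GRing.isLinear.Build K W W *:%R _ Llin).
have L_onto : limg (linfun L) = fullv.
  apply: lker0_limgf; apply/lker0P => u v; rewrite !lfunE /= => e.
  apply/eqP; rewrite -subr_eq0; apply/eqP/Binj => z.
  have -> : u - v = (-1) *: v + u by rewrite scaleN1r addrC.
  by rewrite Bl (repr_inj _ _ (Br u) (Br v) e) mulN1r addNr.
have /memv_imgP[w _ e] : repr f \in limg (linfun L) by rewrite L_onto memvf.
exists w; apply: repr_inj (Br w) flin _.
by rewrite e lfunE.
Qed.

(** * Plane vectors *)

Lemma dotE (R : realType) (u v : 'cV[R]_2) :
  dot u v = u 0 0 * v 0 0 + u 1 0 * v 1 0.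
Proof.
rewrite /dot !big_ord_recl big_ord0 addr0.
by have -> : lift ord0 ord0 = 1 :> 'I_2 by apply/val_inj.
Qed.

Lemma perp0E (R : realType) (v : 'cV[R]_2) : perp v 0 0 = v 1 0.
Proof. by rewrite mxE. Qed.

Lemma perp1E (R : realType) (v : 'cV[R]_2) : perp v 1 0 = - v 0 0.
Proof. by rewrite mxE. Qed.

Lemma mulmx_colE (R : realType) (A : 'M[R]_2) (v : 'cV[R]_2) i :
  (A *m v) i 0 = A i 0 * v 0 0 + A i 1 * v 1 0.
Proof.
rewrite mxE !big_ord_recl big_ord0 addr0.
by have -> : lift ord0 ord0 = 1 :> 'I_2 by apply/val_inj.
Qed.

Lemma colP2 (R : realType) (u v : 'cV[R]_2) :
  u 0 0 = v 0 0 -> u 1 0 = v 1 0 -> u = v.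
Proof.
move=> h0 h1; apply/colP => i.
case: i => [[|[|//]] ?].
- by rewrite (_ : Ordinal _ = 0) //; apply/val_inj.
- by rewrite (_ : Ordinal _ = 1) //; apply/val_inj.
Qed.

Lemma orthogonal_to_two (R : realType) (c p q : 'cV[R]_2) :
  dot c p = 0 -> dot c q = 0 -> dot p (perp q) <> 0 -> c = 0.
Proof.
rewrite !dotE perp0E perp1E => cp cq /eqP pq.
have h0 : c 0 0 * (p 0 0 * q 1 0 + p 1 0 * - q 0 0) = 0.
  transitivity (q 1 0 * (c 0 0 * p 0 0 + c 1 0 * p 1 0)
                - p 1 0 * (c 0 0 * q 0 0 + c 1 0 * q 1 0)); first by ring.
  by rewrite cp cq !mulr0 subr0.
have h1 : c 1 0 * (p 0 0 * q 1 0 + p 1 0 * - q 0 0) = 0.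
  transitivity (p 0 0 * (c 0 0 * q 0 0 + c 1 0 * q 1 0)
                - q 0 0 * (c 0 0 * p 0 0 + c 1 0 * p 1 0)); first by ring.
  by rewrite cp cq !mulr0 subr0.
by apply: colP2; rewrite [RHS]mxE; apply/eqP;
  [move/eqP: h0|move/eqP: h1]; rewrite mulf_eq0 (negPf pq) orbF.
Qed.

(** * The discrete problem on a cyclic mesh *)

(** Indices live in the cyclic group of order N = n + 2: node i carries the
value at rho_i, and edge i joins node i to node i + 1, so periodicity is built
into the addition. *)
Definition jump (n : nat) (V : zmodType) (u : 'I_n.+2 -> V) (i : 'I_n.+2) : V :=
  u (i + 1) - u i.

Definition mass (R : realType) (n : nat) (w Y : 'I_n.+2 -> 'cV[R]_2)
    (phi : 'I_n.+2 -> R) : R :=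
  2^-1 * \sum_i (phi (i + 1) * dot (Y (i + 1)) (w i) + phi i * dot (Y i) (w i)).

Definition stiff_scal (R : realType) (n : nat) (k mu phi : 'I_n.+2 -> R) : R :=
  \sum_i k i * (jump mu i * jump phi i).

Definition stiff_vec (R : realType) (n : nat) (A : 'I_n.+2 -> 'M[R]_2)
    (Y Z : 'I_n.+2 -> 'cV[R]_2) : R :=
  \sum_i dot (A i *m jump Y i) (jump Z i).

(** Collecting the two edges that meet at a node: the lumped product couples
nodal values only with the sum of the two adjacent edge weights. *)
Lemma mass_nodal (R : realType) (n : nat) (w Y : 'I_n.+2 -> 'cV[R]_2)
    (phi : 'I_n.+2 -> R) :
  mass w Y phi = 2^-1 * \sum_i phi i * dot (Y i) (w (i - 1) + w i).
Proof.
rewrite /mass big_split /=; congr (_ * _).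
rewrite (reindex_inj (addIr (- 1 : 'I_n.+2))) /= -big_split /=.
by apply: eq_bigr => i _; rewrite addrNK !dotE !mxE; ring.
Qed.

Lemma jump0_const (n : nat) (V : zmodType) (u : 'I_n.+2 -> V) :
  (forall i, jump u i = 0) -> forall i, u i = u 0.
Proof.
move=> h i; rewrite -(natr_Zp i); elim: (i : nat) => [//|k <-].
by rewrite -[k.+1]addn1 natrD; apply/eqP; rewrite -subr_eq0; apply/eqP/h.
Qed.

Notation unknowns R n :=
  ({ffun 'I_n.+2 -> 'cV[R]_2} * {ffun 'I_n.+2 -> R^o})%type.

(** The left-hand sides of the two equations, added: testing with (0, phi) and
(omega, 0) recovers them separately. *)
Definition saddle (R : realType) (n : nat) (t : R) (w : 'I_n.+2 -> 'cV[R]_2)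
    (k : 'I_n.+2 -> R) (A : 'I_n.+2 -> 'M[R]_2) (U Z : unknowns R n) : R :=
  (t * mass w U.1 Z.2 + stiff_scal k U.2 Z.2)
  + (mass w Z.1 U.2 - stiff_vec A U.1 Z.1).

Lemma mass_linear1 (R : realType) (n : nat) (w : 'I_n.+2 -> 'cV[R]_2)
    (phi : 'I_n.+2 -> R) (a : R) (Y Z : {ffun 'I_n.+2 -> 'cV[R]_2}) :
  mass w (a *: Y + Z) phi = a * mass w Y phi + mass w Z phi.
Proof.
rewrite /mass mulrCA -mulrDr; congr (_ * _); rewrite big_distrr -big_split /=.
by apply: eq_bigr => i _; rewrite !ffunE !dotE !mxE; ring.
Qed.

Lemma mass_linear2 (R : realType) (n : nat) (w Y : 'I_n.+2 -> 'cV[R]_2)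
    (a : R) (p q : {ffun 'I_n.+2 -> R^o}) :
  mass w Y (a *: p + q) = a * mass w Y p + mass w Y q.
Proof.
rewrite /mass mulrCA -mulrDr; congr (_ * _); rewrite big_distrr -big_split /=.
by apply: eq_bigr => i _; rewrite !ffunE /GRing.scale /=; ring.
Qed.

Lemma stiff_scal_linear1 (R : realType) (n : nat) (k q : 'I_n.+2 -> R)
    (a : R) (p p' : {ffun 'I_n.+2 -> R^o}) :
  stiff_scal k (a *: p + p') q = a * stiff_scal k p q + stiff_scal k p' q.
Proof.
rewrite /stiff_scal big_distrr -big_split /=.
by apply: eq_bigr => i _; rewrite /jump !ffunE /GRing.scale /=; ring.
Qed.

Lemma stiff_scal_linear2 (R : realType) (n : nat) (k q : 'I_n.+2 -> R)
    (a : R) (p p' : {ffun 'I_n.+2 -> R^o}) :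
  stiff_scal k q (a *: p + p') = a * stiff_scal k q p + stiff_scal k q p'.
Proof.
rewrite /stiff_scal big_distrr -big_split /=.
by apply: eq_bigr => i _; rewrite /jump !ffunE /GRing.scale /=; ring.
Qed.

Lemma stiff_vec_linear1 (R : realType) (n : nat) (A : 'I_n.+2 -> 'M[R]_2)
    (Z : 'I_n.+2 -> 'cV[R]_2) (a : R) (Y Y' : {ffun 'I_n.+2 -> 'cV[R]_2}) :
  stiff_vec A (a *: Y + Y') Z = a * stiff_vec A Y Z + stiff_vec A Y' Z.
Proof.
rewrite /stiff_vec big_distrr -big_split /=.
by apply: eq_bigr => i _; rewrite !dotE !mulmx_colE /jump !ffunE !mxE; ring.
Qed.

Lemma stiff_vec_linear2 (R : realType) (n : nat) (A : 'I_n.+2 -> 'M[R]_2)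
    (Z : 'I_n.+2 -> 'cV[R]_2) (a : R) (Y Y' : {ffun 'I_n.+2 -> 'cV[R]_2}) :
  stiff_vec A Z (a *: Y + Y') = a * stiff_vec A Z Y + stiff_vec A Z Y'.
Proof.
rewrite /stiff_vec big_distrr -big_split /=.
by apply: eq_bigr => i _; rewrite !dotE /jump !ffunE !mxE; ring.
Qed.

Lemma mass0l (R : realType) (n : nat) (w : 'I_n.+2 -> 'cV[R]_2)
    (phi : 'I_n.+2 -> R) : mass w (0 : {ffun 'I_n.+2 -> 'cV[R]_2}) phi = 0.
Proof.
by rewrite /mass big1 ?mulr0// => i _; rewrite !ffunE !dotE !mxE; ring.
Qed.

Lemma mass0r (R : realType) (n : nat) (w Y : 'I_n.+2 -> 'cV[R]_2) :
  mass w Y (0 : {ffun 'I_n.+2 -> R^o}) = 0.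
Proof. by rewrite /mass big1 ?mulr0// => i _; rewrite !ffunE; ring. Qed.

Lemma stiff_scal0r (R : realType) (n : nat) (k mu : 'I_n.+2 -> R) :
  stiff_scal k mu (0 : {ffun 'I_n.+2 -> R^o}) = 0.
Proof. by rewrite /stiff_scal big1// => i _; rewrite /jump !ffunE; ring. Qed.

Lemma stiff_vec0r (R : realType) (n : nat) (A : 'I_n.+2 -> 'M[R]_2)
    (Y : 'I_n.+2 -> 'cV[R]_2) :
  stiff_vec A Y (0 : {ffun 'I_n.+2 -> 'cV[R]_2}) = 0.
Proof.
by rewrite /stiff_vec big1// => i _; rewrite /jump !ffunE !dotE !mxE; ring.
Qed.

Lemma saddle_linear1 (R : realType) (n : nat) (t : R) (w : 'I_n.+2 -> 'cV[R]_2)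
    (k : 'I_n.+2 -> R) (A : 'I_n.+2 -> 'M[R]_2) (Z : unknowns R n) :
  linear_for *%R (fun U => saddle t w k A U Z).
Proof.
move=> a U V; rewrite /saddle /= mass_linear1 mass_linear2 stiff_scal_linear1.
by rewrite stiff_vec_linear1; ring.
Qed.

Lemma saddle_linear2 (R : realType) (n : nat) (t : R) (w : 'I_n.+2 -> 'cV[R]_2)
    (k : 'I_n.+2 -> R) (A : 'I_n.+2 -> 'M[R]_2) (U : unknowns R n) :
  linear_for *%R (saddle t w k A U).
Proof.
move=> a Z V; rewrite /saddle /= mass_linear1 mass_linear2 stiff_scal_linear2.
by rewrite stiff_vec_linear2; ring.
Qed.

(** The discrete energy argument: the coupling terms cancel on the diagonal, so
the two stiffness forms vanish and U is constant; then only the coupling is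
left, which sees the constants through the nodal weights. *)
Lemma saddle_nondegenerate (R : realType) (n : nat) (t : R)
    (w : 'I_n.+2 -> 'cV[R]_2) (k : 'I_n.+2 -> R) (A : 'I_n.+2 -> 'M[R]_2) :
  0 < t -> (forall i, 0 < k i) ->
  (forall i (v : 'cV[R]_2), v != 0 -> 0 < dot (A i *m v) v) ->
  (exists i1 i2, dot (w (i1 - 1) + w i1) (perp (w (i2 - 1) + w i2)) <> 0) ->
  forall U, (forall Z, saddle t w k A U Z = 0) -> U = 0.
Proof.
move=> t0 k0 A0 [i1 [i2 w12]] [Y mu] h.
have A0' i v : 0 <= dot (A i *m v) v.
  have [->|/A0/ltW//] := eqVneq v 0.
  by rewrite dotE !mxE !mulr0 addr0.
(* The test pair (- t Y, mu) cancels the two copies of the coupling term. *)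
have energy : stiff_scal k mu mu + t * stiff_vec A Y Y = 0.
  have := h ((- t) *: Y + 0, mu); rewrite /saddle /=.
  by rewrite mass_linear1 stiff_vec_linear2 mass0l stiff_vec0r => <-; ring.
have s0 : 0 <= stiff_scal k mu mu.
  by apply: sumr_ge0 => i _; rewrite mulr_ge0 ?(ltW (k0 i))// -expr2 sqr_ge0.
have a0 : 0 <= stiff_vec A Y Y by apply: sumr_ge0 => i _; exact: A0'.
move/eqP: energy; rewrite paddr_eq0 ?mulr_ge0 ?(ltW t0)// mulf_eq0 (gt_eqF t0) /=.
case/andP => /eqP smu /eqP aY.
have jmu i : jump mu i = 0.
  have pos j : true -> 0 <= k j * (jump mu j * jump mu j).
    by move=> _; rewrite mulr_ge0 ?(ltW (k0 j))// -expr2 sqr_ge0.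
  have /eqP := @psumr_eq0P _ _ _ _ pos smu i isT.
  by rewrite mulf_eq0 (gt_eqF (k0 i)) /= mulf_eq0 orbb => /eqP.
have jY i : jump Y i = 0.
  have /eqP := @psumr_eq0P _ _ _ _ (fun i _ => A0' i (jump Y i)) aY i isT.
  by apply: contraTeq => /A0 H; rewrite gt_eqF.
(* Test pairs concentrated at the single node i. *)
have Y_orth i : dot (Y 0) (w (i - 1) + w i) = 0.
  have := h (0, [ffun j => (j == i)%:R]); rewrite /saddle /= mass0l stiff_vec0r subr0.
  rewrite /stiff_scal big1 ?addr0 => [|j _]; last by rewrite jmu mul0r mulr0.
  move/eqP; rewrite mulf_eq0 (gt_eqF t0) /= mass_nodal mulf_eq0 invr_eq0.
  rewrite pnatr_eq0 /= (bigD1 i) //= big1 => [|j /negPf ji]; last first.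
    by rewrite ffunE ji mul0r.
  by rewrite ffunE eqxx mul1r addr0 (jump0_const jY) => /eqP.
have mu_orth i : mu 0 * dot (w (i - 1) + w i) (w (i - 1) + w i) = 0.
  have := h ([ffun j => (j == i)%:R *: (w (i - 1) + w i)], 0).
  rewrite /saddle /= mass0r stiff_scal0r mulr0 !add0r.
  rewrite /stiff_vec big1 ?subr0 => [|j _]; last first.
    by rewrite jY mulmx0 dotE !mxE !mul0r addr0.
  move/eqP; rewrite mass_nodal mulf_eq0 invr_eq0.
  rewrite pnatr_eq0 /= (bigD1 i) //= big1 => [|j /negPf ji]; last first.
    by rewrite ffunE ji scale0r dotE !mxE !mul0r addr0 mulr0.
  by rewrite ffunE eqxx scale1r addr0 (jump0_const jmu) => /eqP.
have Y0 : Y 0 = 0 by apply: orthogonal_to_two (Y_orth i1) (Y_orth i2) w12.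
have mu0 : mu 0 = 0.
  have /eqP := mu_orth i1; rewrite mulf_eq0 => /orP[/eqP//|].
  rewrite dotE -!expr2 paddr_eq0 ?sqr_ge0// !sqrf_eq0 => /andP[/eqP e0 /eqP e1].
  by case: w12; rewrite dotE e0 e1 !mul0r addr0.
by congr (_, _); apply/ffunP => i; rewrite (jump0_const jY, jump0_const jmu) ffunE.
Qed.

(** * One-sided limits at the nodes *)

Lemma ltr_rho (R : realType) (N i j : nat) : (0 < N)%N ->
  (rho R N i < rho R N j) = (i < j)%N.
Proof.
by move=> N0; rewrite /rho ltr_pM2r ?ltr_nat// divr_gt0 ?ltr01 ?ltr0n.
Qed.

Lemma ler_rho (R : realType) (N i j : nat) : (0 < N)%N ->
  (rho R N i <= rho R N j) = (i <= j)%N.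
Proof. by move=> N0; rewrite !leNgt ltr_rho// -leqNgt. Qed.

Lemma rho0 (R : realType) (N : nat) : rho R N 0 = 0.
Proof. by rewrite /rho mul0r. Qed.

Lemma rhoNN (R : realType) (N : nat) : (0 < N)%N -> rho R N N = 1.
Proof. by move=> N0; rewrite /rho mul1r divff// pnatr_eq0 -lt0n. Qed.

Lemma piecewiseE (R : realType) (V : nmodType) (N : nat) (c : nat -> V)
    (j : nat) (x : R) : (j < N)%N -> rho R N j < x < rho R N j.+1 ->
  piecewise N c x = c j.+1.
Proof.
move=> jN /andP[jx xj]; have N0 : (0 < N)%N by exact: leq_ltn_trans jN.
rewrite /piecewise big_mkcond big_add1 /= big_mkord (bigD1 (Ordinal jN)) //=.
rewrite jx xj /= big1 ?addr0// => i /negP ij; case: ifP => // /andP[ix xi].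
have ij1 : (i < j.+1)%N by rewrite -(ltr_rho R _ _ N0) (lt_trans ix xj).
have ji1 : (j < i.+1)%N by rewrite -(ltr_rho R _ _ N0) (lt_trans jx xi).
by case: ij; apply/eqP/val_inj/anti_leq; rewrite /= -ltnS ij1 -ltnS ji1.
Qed.

(** A lumped product reads its integrand through the limits from inside each
edge; [l j] and [r j] belong to the two ends of the edge from rho_j to
rho_(j+1). *)
Definition traces (R : realType) (N : nat) (w : R -> R) (l r : nat -> R) : Prop :=
  forall j, (j < N)%N -> w x @[x --> (rho R N j)^'+] --> l j
                      /\ w x @[x --> (rho R N j.+1)^'-] --> r j.

Definition vtraces (R : realType) (N : nat) (v : R -> 'cV[R]_2)
    (l r : nat -> 'cV[R]_2) : Prop :=
  forall i, traces N (fun x => v x i 0) (fun j => l j i 0) (fun j => r j i 0).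

Lemma traces_affine (R : realType) (N : nat) (w : R -> R) (l r : nat -> R) :
  (forall j, (j < N)%N -> exists a b : R,
    [/\ forall x, rho R N j < x < rho R N j.+1 -> w x = a + b * x,
        l j = a + b * rho R N j & r j = a + b * rho R N j.+1]) ->
  traces N w l r.
Proof.
move=> h j jN; have [a [b [wE -> ->]]] := h j jN.
have jj : rho R N j < rho R N j.+1 by rewrite ltr_rho// (leq_ltn_trans _ jN).
have aff y : a + b * x @[x --> y] --> a + b * y.
  by apply: cvgD; [exact: cvg_cst|apply: cvgM; [exact: cvg_cst|exact: cvg_id]].
split.
- apply: cvg_trans (cvg_at_right_filter (aff _)); apply: near_eq_cvg.
  near=> x; rewrite wE//; apply/andP; split; near: x;
    [exact: nbhs_right_gt|exact: nbhs_right_lt].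
- apply: cvg_trans (cvg_at_left_filter (aff _)); apply: near_eq_cvg.
  near=> x; rewrite wE//; apply/andP; split; near: x;
    [exact: nbhs_left_gt|exact: nbhs_left_lt].
Unshelve. all: by end_near. Qed.

Lemma tracesD (R : realType) (N : nat) (u v : R -> R) (l r l' r' : nat -> R) :
  traces N u l r -> traces N v l' r' ->
  traces N (fun x => u x + v x) (fun j => l j + l' j) (fun j => r j + r' j).
Proof.
move=> hu hv j jN; case: (hu j jN) (hv j jN) => ? ? [? ?].
by split; exact: cvgD.
Qed.

Lemma tracesM (R : realType) (N : nat) (u v : R -> R) (l r l' r' : nat -> R) :
  traces N u l r -> traces N v l' r' ->
  traces N (fun x => u x * v x) (fun j => l j * l' j) (fun j => r j * r' j).
Proof.
move=> hu hv j jN; case: (hu j jN) (hv j jN) => ? ? [? ?].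
by split; exact: cvgM.
Qed.

Lemma eq_traces (R : realType) (N : nat) (u : R -> R) (l r : nat -> R) v l' r' :
  traces N u l r -> u =1 v -> l =1 l' -> r =1 r' -> traces N v l' r'.
Proof. by move=> h /funext <- /funext <- /funext <-. Qed.

Lemma traces_dot (R : realType) (N : nat) (u v : R -> 'cV[R]_2)
    (l r l' r' : nat -> 'cV[R]_2) :
  vtraces N u l r -> vtraces N v l' r' ->
  traces N (fun x => dot (u x) (v x)) (fun j => dot (l j) (l' j))
    (fun j => dot (r j) (r' j)).
Proof.
move=> hu hv.
apply: eq_traces (tracesD (tracesM (hu 0) (hv 0)) (tracesM (hu 1) (hv 1))) _ _ _;
  by move=> x; rewrite dotE.
Qed.

Lemma traces_cells (R : realType) (N : nat) (w : R -> R) (c : nat -> R) :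
  (forall j x, (j < N)%N -> rho R N j < x < rho R N j.+1 -> w x = c j.+1) ->
  traces N w (fun j => c j.+1) (fun j => c j.+1).
Proof.
move=> h; apply: traces_affine => j jN; exists (c j.+1), 0; split=> [x||];
by rewrite mul0r addr0//; exact: h.
Qed.

Lemma vtraces_cells (R : realType) (N : nat) (w : R -> 'cV[R]_2)
    (c : nat -> 'cV[R]_2) :
  (forall j x, (j < N)%N -> rho R N j < x < rho R N j.+1 -> w x = c j.+1) ->
  vtraces N w (fun j => c j.+1) (fun j => c j.+1).
Proof.
move=> h i; apply: (@traces_cells R N _ (fun j => c j i 0)) => j x jN jx.
by rewrite (h j).
Qed.

Lemma traces_Kph (R : realType) (N : nat) (u : R -> R) : Kph N u ->
  traces N u (fun j => u (rho R N j)) (fun j => u (rho R N j.+1)).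
Proof.
move=> [_ aff _]; apply: traces_affine => j jN; have [a [b e]] := aff j.+1 jN.
have N0 : (0 < N)%N by exact: leq_ltn_trans jN.
exists a, b; split=> [x /andP[jx xj]||]; apply: e; rewrite in_itv /= ?ler_rho//.
- by rewrite !ltW.
- by rewrite leqnn leqnSn.
- by rewrite leqnn leqnSn.
Qed.

Lemma vtraces_Xph (R : realType) (N : nat) (u : R -> 'cV[R]_2) : Xph N u ->
  vtraces N u (fun j => u (rho R N j)) (fun j => u (rho R N j.+1)).
Proof. by move=> h i; exact: traces_Kph (h i). Qed.

Lemma lumped_traces (R : realType) (N : nat) (X : R -> 'cV[R]_2) (w : R -> R)
    (l r : nat -> R) : traces N w l r ->
  lumped N X w = 2^-1 * \sum_(j < N) enorm (edge N X j.+1) * (r j + l j).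
Proof.
move=> h; rewrite /lumped big_add1 /= big_mkord; congr (_ * _).
apply: eq_bigr => j _; have [hl hr] := h j (ltn_ord j).
by congr (_ * (_ + _)); apply: cvg_lim.
Qed.

(** * From finite element functions to nodal values *)

Definition nodal (R : realType) (n : nat) (V : Type) (u : R -> V) :
  {ffun 'I_n.+2 -> V} := [ffun i : 'I_n.+2 => u (rho R n.+2 i)].

Lemma nodal_succ (R : realType) (n : nat) (V : Type) (u : R -> V) (i : 'I_n.+2) :
  u 0 = u 1 -> u (rho R n.+2 i.+1) = nodal n u (i + 1).
Proof.
move=> u01; rewrite ffunE /= modnDmr addn1.
have [lt|] := ltnP i.+1 n.+2; first by rewrite modn_small.
rewrite leq_eqVlt ltnNge ltn_ord orbF => /eqP <-.
by rewrite modnn rho0 rhoNN.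
Qed.

Lemma Xph_periodic (R : realType) (N : nat) (Y : R -> 'cV[R]_2) :
  Xph N Y -> Y 0 = Y 1.
Proof. by move=> h; apply/colP => i; case: (h i). Qed.

(** The length of an edge times its unit normal.  Edge i of the cyclic mesh is
number i + 1 among the edges of the curve, which are counted from 1. *)
Definition edge_weight (R : realType) (n : nat) (X : R -> 'cV[R]_2)
    (i : 'I_n.+2) : 'cV[R]_2 := - perp (edge n.+2 X i.+1).

Definition edge_conductance (R : realType) (n : nat) (X : R -> 'cV[R]_2)
    (i : 'I_n.+2) : R := (enorm (edge n.+2 X i.+1))^-1.

Definition edge_matrix (R : realType) (gamma : R -> R) (n : nat)
    (X : R -> 'cV[R]_2) (theta : nat -> R) (i : 'I_n.+2) : 'M[R]_2 :=
  (enorm (edge n.+2 X i.+1))^-1 *: Gmat gamma (theta i.+1).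

(** Both coupling terms of the scheme have this shape, up to the order of the
factors. *)
Lemma lumped_mass (R : realType) (n : nat) (X V : R -> 'cV[R]_2) (phi : R -> R) :
  (forall j, (1 <= j <= n.+2)%N -> 0 < enorm (edge n.+2 X j)) ->
  Xph n.+2 V -> Kph n.+2 phi ->
  lumped n.+2 X (fun x => phi x * dot (V x) (normal n.+2 X x))
  = mass (edge_weight (n := n) X) (nodal n V) (nodal n (phi : R -> R^o)).
Proof.
move=> nd hV hphi.
pose nu j := - ((enorm (edge n.+2 X j))^-1 *: perp (edge n.+2 X j)).
have hn : vtraces n.+2 (normal n.+2 X) (fun j => nu j.+1) (fun j => nu j.+1).
  by apply: vtraces_cells => j x jN jx; rewrite /normal (piecewiseE _ jN jx).
have := tracesM (traces_Kph hphi) (traces_dot (vtraces_Xph hV) hn).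
move=> /(lumped_traces X) ->; rewrite /mass; congr (_ * _).
apply: eq_bigr => i _.
have [_ _ p01] := hphi.
rewrite (nodal_succ i (Xph_periodic hV)) (@nodal_succ R n R^o phi i p01).
rewrite /edge_weight /nu !ffunE !dotE !mxE.
have /gt_eqF/negbT := nd i.+1 (ltn_ord i).
by move: (enorm _) => e e0; field.
Qed.

Lemma ip_scal_ds (R : realType) (n : nat) (X : R -> 'cV[R]_2) (mu phi : R -> R) :
  (forall j, (1 <= j <= n.+2)%N -> 0 < enorm (edge n.+2 X j)) ->
  Kph n.+2 mu -> Kph n.+2 phi ->
  ip_scal n.+2 X (ds (V := R^o) n.+2 X mu) (ds (V := R^o) n.+2 X phi)
  = stiff_scal (edge_conductance (n := n) X) (nodal n (mu : R -> R^o))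
      (nodal n (phi : R -> R^o)).
Proof.
move=> nd hmu hphi.
pose c (u : R -> R) j :=
  (enorm (edge n.+2 X j))^-1 * (u (rho R n.+2 j) - u (rho R n.+2 j.-1)).
have /(lumped_traces X) : traces n.+2
    (fun x => ds (V := R^o) n.+2 X mu x * ds (V := R^o) n.+2 X phi x)
    (fun j => c mu j.+1 * c phi j.+1) (fun j => c mu j.+1 * c phi j.+1).
  apply: (@traces_cells R n.+2 _ (fun j => c mu j * c phi j)) => j x jN jx.
  by rewrite /ds !(piecewiseE _ jN jx).
rewrite /ip_scal => ->; rewrite /stiff_scal big_distrr /=; apply: eq_bigr => i _.
have [_ _ p01] := hphi; have [_ _ m01] := hmu.
rewrite /c /jump /edge_conductance (@nodal_succ R n R^o phi i p01).
rewrite (@nodal_succ R n R^o mu i m01) !ffunE /=.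
have /gt_eqF/negbT := nd i.+1 (ltn_ord i).
by move: (enorm _) => e e0; field.
Qed.

Lemma ip_vec_ds (R : realType) (gamma : R -> R) (n : nat) (X Y om : R -> 'cV[R]_2)
    (theta : nat -> R) :
  (forall j, (1 <= j <= n.+2)%N -> 0 < enorm (edge n.+2 X j)) ->
  Xph n.+2 Y -> Xph n.+2 om ->
  ip_vec n.+2 X
    (fun x => Gmat gamma (piecewise n.+2 theta x) *m ds n.+2 X Y x)
    (ds n.+2 X om)
  = stiff_vec (edge_matrix (n := n) gamma X theta) (nodal n Y) (nodal n om).
Proof.
move=> nd hY hom.
pose c (u : R -> 'cV[R]_2) j :=
  (enorm (edge n.+2 X j))^-1 *: (u (rho R n.+2 j) - u (rho R n.+2 j.-1)).
pose d j := dot (Gmat gamma (theta j) *m c Y j) (c om j).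
have /(lumped_traces X) : traces n.+2
    (fun x => dot (Gmat gamma (piecewise n.+2 theta x) *m ds n.+2 X Y x)
                (ds n.+2 X om x)) (fun j => d j.+1) (fun j => d j.+1).
  by apply: traces_cells => j x jN jx; rewrite /ds !(piecewiseE _ jN jx).
rewrite /ip_vec => ->; rewrite /stiff_vec big_distrr /=; apply: eq_bigr => i _.
rewrite /d /c /jump /edge_matrix (nodal_succ i (Xph_periodic hY)).
rewrite (nodal_succ i (Xph_periodic hom)) !ffunE.
move: (Gmat _ _) => G; rewrite -!scalemxAl -!scalemxAr.
have dotZ a b (u v : 'cV[R]_2) : dot (a *: u) (b *: v) = a * b * dot u v.
  by rewrite !dotE !mxE; ring.
rewrite dotZ -[X in _ = dot _ X]scale1r dotZ /=.
move: (dot _ _) => d0.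
have /gt_eqF/negbT := nd i.+1 (ltn_ord i).
by move: (enorm _) => e e0; field.
Qed.

Lemma Kph_linear (R : realType) (N : nat) (u v : R -> R) (a b : R) :
  Kph N u -> Kph N v -> Kph N (fun x => a * u x + b * v x).
Proof.
move=> [cu au pu] [cv av pv]; split; last by rewrite pu pv.
- move=> x; apply: cvgD; apply: cvgM; by [exact: cvg_cst|exact: cu|exact: cv].
- move=> j jN; have [a1 [b1 e1]] := au j jN; have [a2 [b2 e2]] := av j jN.
  exists (a * a1 + b * a2), (a * b1 + b * b2) => x jx.
  by rewrite (e1 x jx) (e2 x jx); ring.
Qed.

(** * From nodal values to finite element functions *)

Definition hat (R : realType) (t : R) : R := Num.max 0 (1 - `|t|).

(** Node N is identified with node 0 by [inZp], so v 0 weights the hats at both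
ends of the unit interval. *)
Definition interp (R : realType) (n : nat) (v : 'I_n.+2 -> R) (x : R) : R :=
  \sum_(k < n.+3) v (inZp k) * hat (n.+2%:R * x - k%:R).

Lemma hat_continuous (R : realType) : continuous (@hat R).
Proof.
move=> t.
apply: (@continuous_max R R (fun=> 0) (fun t => 1 - `|t|) t); first exact: cvg_cst.
by apply: cvgB; [exact: cvg_cst|exact: cvg_norm].
Qed.

Lemma hat_nat (R : realType) (i k : nat) : hat (i%:R - k%:R : R) = (i == k)%:R.
Proof.
rewrite /hat; have [->|ik] := eqVneq i k.
  by rewrite subrr normr0 subr0 max_r.
apply: max_l; rewrite subr_le0; case: (ltngtP i k) ik => // ik _.
- by rewrite distrC ger0_norm ?subr_ge0 ?ler_nat ?(ltnW ik)// lerBrDr nat1r ler_nat.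
- by rewrite ger0_norm ?subr_ge0 ?ler_nat ?(ltnW ik)// lerBrDr nat1r ler_nat.
Qed.

Lemma natr_mul_rho (R : realType) (N i : nat) : (0 < N)%N ->
  N%:R * rho R N i = i%:R.
Proof. by move=> N0; rewrite /rho mulrCA mul1r mulfV ?mulr1// pnatr_eq0 -lt0n. Qed.

Lemma interp_rho (R : realType) (n : nat) (v : 'I_n.+2 -> R) (i : nat) :
  (i < n.+3)%N -> interp v (rho R n.+2 i) = v (inZp i).
Proof.
move=> iN; rewrite /interp (bigD1 (Ordinal iN)) //= natr_mul_rho// hat_nat eqxx.
rewrite mulr1 big1 ?addr0// => k /negPf ki; rewrite hat_nat.
by move: ki; rewrite -val_eqE /= eq_sym => ->; rewrite mulr0.
Qed.

(** The kinks of the hat centred at k are at k - 1, k and k + 1, so none lies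
strictly between consecutive integers. *)
Lemma hat_affine (R : realType) (j k : nat) : exists a b : R,
  forall t, j%:R <= t <= j.+1%:R -> hat (t - k%:R) = a + b * t.
Proof.
have [jk|kj] := ltnP j k.
- have jk' : j.+1%:R <= k%:R :> R by rewrite ler_nat.
  have [e|ne] := eqVneq k j.+1.
    exists (1 - k%:R), 1 => t /andP[jt tj].
    rewrite e /hat ler0_norm; last lra.
    rewrite max_r; first lra.
    by move: tj jt; rewrite -natr1; lra.
  have lt : j.+2%:R <= k%:R :> R by rewrite ler_nat ltn_neqAle eq_sym ne.
  exists 0, 0 => t /andP[jt tj]; move: lt; rewrite -natr1 => lt.
  rewrite /hat ler0_norm; last lra.
  by rewrite max_l; lra.
- have kj' : k%:R <= j%:R :> R by rewrite ler_nat.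
  have [e|ne] := eqVneq k j.
    exists (1 + k%:R), (-1) => t /andP[jt tj].
    rewrite e /hat ger0_norm; last lra.
    rewrite max_r; first lra.
    by move: tj jt; rewrite -natr1; lra.
  have lt : k.+1%:R <= j%:R :> R by rewrite ler_nat ltn_neqAle ne.
  exists 0, 0 => t /andP[jt tj]; move: lt; rewrite -natr1 => lt.
  rewrite /hat ger0_norm; last lra.
  by rewrite max_l; lra.
Qed.

Lemma interp_Kph (R : realType) (n : nat) (v : 'I_n.+2 -> R) : Kph n.+2 (interp v).
Proof.
split.
- apply: continuous_subspaceT => x.
  apply: (continuous_big (P := xpredT) add_continuous) => k _.
  move=> y; apply: cvgM; first exact: cvg_cst.
  apply: (@cvg_comp _ _ _ (fun y => n.+2%:R * y - k%:R) (@hat R));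
    last exact: hat_continuous.
  apply: cvgB; last exact: cvg_cst.
  by apply: cvgM; [exact: cvg_cst|exact: cvg_id].
- case=> // j jN.
  have aff k : exists ab : R * R, forall x,
      rho R n.+2 j <= x <= rho R n.+2 j.+1 ->
      v (inZp k) * hat (n.+2%:R * x - k%:R) = ab.1 + ab.2 * x.
    have [a [b e]] := hat_affine R j k.
    exists (v (inZp k) * a, v (inZp k) * b * n.+2%:R) => x /andP[jx xj].
    rewrite e /=; first by ring.
    by rewrite -(@natr_mul_rho R n.+2 j)// -(@natr_mul_rho R n.+2 j.+1)// !ler_pM2l ?jx ?ltr0n.
  have [ab abE] := choice aff.
  exists (\sum_(k < n.+3) (ab k).1), (\sum_(k < n.+3) (ab k).2) => x.
  rewrite in_itv /= => jx; rewrite /interp mulr_suml -big_split /=.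
  by apply: eq_bigr => k _; exact: abE.
- have := @interp_rho R n v 0 isT; rewrite rho0 => ->.
  have := @interp_rho R n v n.+2 (leqnn _); rewrite rhoNN// => ->.
  by congr v; apply/val_inj; rewrite /= modnn.
Qed.

Lemma nodal_interp (R : realType) (n : nat) (v : {ffun 'I_n.+2 -> R^o}) :
  nodal n (interp v : R -> R^o) = v.
Proof.
apply/ffunP => i; rewrite ffunE interp_rho ?valZpK//.
by apply: leq_trans (ltn_ord i) _.
Qed.

Definition vinterp (R : realType) (n : nat) (v : 'I_n.+2 -> 'cV[R]_2) (x : R) :
  'cV[R]_2 := \col_c interp (fun k => v k c 0) x.

Lemma vinterp_Xph (R : realType) (n : nat) (v : 'I_n.+2 -> 'cV[R]_2) :
  Xph n.+2 (vinterp v).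
Proof.
move=> c; have := interp_Kph (fun k => v k c 0); congr Kph.
by apply/funext => x; rewrite mxE.
Qed.

Lemma nodal_vinterp (R : realType) (n : nat) (v : {ffun 'I_n.+2 -> 'cV[R]_2}) :
  nodal n (vinterp v) = v.
Proof.
apply/ffunP => i; apply/colP => c; rewrite ffunE mxE interp_rho ?valZpK//.
by apply: leq_trans (ltn_ord i) _.
Qed.

Lemma unit_interval_cell (R : realType) (N : nat) (x : R) : (0 < N)%N ->
  0 <= x <= 1 -> exists2 j, (j < N)%N & rho R N j <= x <= rho R N j.+1.
Proof.
move=> N0 /andP[x0]; rewrite -(rhoNN R N0).
suff : forall k, (k < N)%N -> x <= rho R N k.+1 ->
    exists2 j, (j < N)%N & rho R N j <= x <= rho R N j.+1.
  by move=> /(_ N.-1); rewrite prednK// => /(_ (leqnn _)).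
elim=> [|k IHk] kN xk; first by exists 0%N; rewrite // rho0 x0.
have [xk'|kx] := leP x (rho R N k.+1); first by apply: IHk => //; exact: ltnW.
by exists k.+1; rewrite // (ltW kx).
Qed.

(** On each edge, an affine function is determined by its values at the two
distinct end points. *)
Lemma Kph_nodal_inj (R : realType) (n : nat) (u v : R -> R) :
  Kph n.+2 u -> Kph n.+2 v ->
  nodal n (u : R -> R^o) = nodal n (v : R -> R^o) -> {in `[0, 1], u =1 v}.
Proof.
move=> hu hv uv x; rewrite in_itv /= => x01.
have [j jN jx] := unit_interval_cell (ltn0Sn n.+1) x01.
have [_ au pu] := hu; have [_ av pv] := hv.
have el : u (rho R n.+2 j) = v (rho R n.+2 j).
  by have /ffunP/(_ (Ordinal jN)) := uv; rewrite !ffunE.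
have er : u (rho R n.+2 j.+1) = v (rho R n.+2 j.+1).
  have := @nodal_succ R n R^o u (Ordinal jN) pu; rewrite uv => ->.
  by have := @nodal_succ R n R^o v (Ordinal jN) pv => <-.
have [a [b ab]] := au j.+1 jN; have [c [d cd]] := av j.+1 jN.
have lt : rho R n.+2 j < rho R n.+2 j.+1 by rewrite ltr_rho.
have inl : rho R n.+2 j \in `[rho R n.+2 j.+1.-1, rho R n.+2 j.+1].
  by rewrite in_itv /= lexx ltW.
have inr : rho R n.+2 j.+1 \in `[rho R n.+2 j.+1.-1, rho R n.+2 j.+1].
  by rewrite in_itv /= lexx ltW.
rewrite ab ?in_itv// cd ?in_itv//.
move: el er; rewrite (ab _ inl) (ab _ inr) (cd _ inl) (cd _ inr) => el er.
have bd : b = d.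
  have /eqP : (b - d) * (rho R n.+2 j.+1 - rho R n.+2 j) = 0 by lra.
  by rewrite mulf_eq0 !subr_eq0 (gt_eqF lt) orbF => /eqP.
by move: el; rewrite bd => /addIr ->.
Qed.

Lemma Xph_nodal_inj (R : realType) (n : nat) (u v : R -> 'cV[R]_2) :
  Xph n.+2 u -> Xph n.+2 v -> nodal n u = nodal n v -> {in `[0, 1], u =1 v}.
Proof.
move=> hu hv uv x x01; apply/colP => c.
apply: (Kph_nodal_inj (hu c) (hv c) _ x01); apply/ffunP => i.
by have /ffunP/(_ i) := uv; rewrite !ffunE => ->.
Qed.

(** * The scheme as a linear system *)

(** The known curve enters the first equation only through its coupling term,
which becomes the right-hand side. *)
Lemma is_solution_nodal (R : realType) (gamma : R -> R) (n : nat) (tau : R)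
    (X : R -> 'cV[R]_2) (theta : nat -> R) (Y : R -> 'cV[R]_2) (mu : R -> R) :
  (forall j, (1 <= j <= n.+2)%N -> 0 < enorm (edge n.+2 X j)) ->
  Xph n.+2 X -> Xph n.+2 Y -> Kph n.+2 mu ->
  is_solution gamma n.+2 tau X theta Y mu <->
  forall Z : unknowns R n,
    saddle tau^-1 (edge_weight (n := n) X) (edge_conductance (n := n) X)
      (edge_matrix (n := n) gamma X theta)
      (nodal n Y, nodal n (mu : R -> R^o)) Z
    = tau^-1 * mass (edge_weight (n := n) X) (nodal n X) Z.2.
Proof.
move=> nd hX hY hmu.
have eq1 phi : Kph n.+2 phi ->
    ip_vec n.+2 X (fun x => tau^-1 *: (Y x - X x))
      (fun x => phi x *: normal n.+2 X x)
    = tau^-1 * mass (edge_weight (n := n) X) (nodal n Y) (nodal n (phi : R -> R^o))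
      - tau^-1 * mass (edge_weight (n := n) X) (nodal n X) (nodal n (phi : R -> R^o)).
  move=> hphi.
  have hV : Xph n.+2 (fun x => tau^-1 *: (Y x - X x)).
    move=> c; have := Kph_linear tau^-1 (- tau^-1) (hY c) (hX c); congr Kph.
    by apply/funext => x; rewrite !mxE; ring.
  transitivity (lumped n.+2 X
      (fun x => phi x * dot (tau^-1 *: (Y x - X x)) (normal n.+2 X x))).
    by congr lumped; apply/funext => x; rewrite !dotE !mxE; ring.
  rewrite lumped_mass//.
  have -> : nodal n (fun x => tau^-1 *: (Y x - X x)) =
      tau^-1 *: nodal n Y + ((- tau^-1) *: nodal n X + 0).
    by apply/ffunP => i; rewrite !ffunE addr0 scalerBr scaleNr.
  by rewrite !mass_linear1 mass0l; ring.
have eq2 om : Xph n.+2 om ->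
    ip_scal n.+2 X mu (fun x => dot (normal n.+2 X x) (om x))
    = mass (edge_weight (n := n) X) (nodal n om) (nodal n (mu : R -> R^o)).
  move=> hom; rewrite -lumped_mass//; congr lumped.
  by apply/funext => x; rewrite !dotE; ring.
split.
- move=> [_ _ h1 h2] [om phi] /=.
  have hphi := interp_Kph phi; have hom := vinterp_Xph om.
  move: (h1 _ hphi) (h2 _ hom).
  rewrite eq1// eq2// ip_scal_ds// ip_vec_ds// nodal_interp nodal_vinterp.
  by rewrite /saddle /= => e1 e2; rewrite e2 addr0; move: e1; lra.
- move=> h; split=> // [phi hphi|om hom].
  + have := h (0, nodal n (phi : R -> R^o)).
    by rewrite /saddle /= mass0l stiff_vec0r eq1// ip_scal_ds//; lra.
  + have := h (nodal n om, 0).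
    by rewrite /saddle /= !mass0r stiff_scal0r eq2// ip_vec_ds//; lra.
Qed.

(** The off-diagonal entries of G are opposite, so only gamma contributes to the
quadratic form. *)
Lemma edge_matrix_posdef (R : realType) (gamma : R -> R) (n : nat)
    (X : R -> 'cV[R]_2) (theta : nat -> R) (i : 'I_n.+2) (v : 'cV[R]_2) :
  0 < enorm (edge n.+2 X i.+1) -> 0 < gamma (theta i.+1) -> v != 0 ->
  0 < dot (edge_matrix (n := n) gamma X theta i *m v) v.
Proof.
move=> e0 g0 v0; rewrite /edge_matrix dotE !mulmx_colE !mxE /=.
set e := enorm _; set g := gamma _; set d := derive_on _ _ _ _.
rewrite (_ : _ + _ = e^-1 * g * (v 0 0 ^+ 2 + v 1 0 ^+ 2)); last by ring.
rewrite !mulr_gt0 ?invr_gt0// lt_def addr_ge0 ?sqr_ge0// andbT.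
rewrite paddr_eq0 ?sqr_ge0// !sqrf_eq0; apply: contra v0 => /andP[/eqP v00 /eqP v10].
by apply/eqP; apply: colP2; rewrite [RHS]mxE.
Qed.

(** The two edges meeting at node j add up to the chord between its neighbours.
The last chord, from node 1 to node N - 1, belongs to node 0 and has the
opposite orientation, hence the sign s. *)
Lemma tilde_edge_weight (R : realType) (n : nat) (X : R -> 'cV[R]_2) (j : nat) :
  X 0 = X 1 -> (1 <= j <= n.+1)%N ->
  exists (i : 'I_n.+2) (s : R), s != 0 /\
    edge_weight (n := n) X (i - 1) + edge_weight (n := n) X i
    = s *: perp (tilde_edge n.+2 X j).
Proof.
move=> X01; case: j => // j /= jn; rewrite /tilde_edge subSS subSS subn0.
have [{}jn|nj] := ltnP j n.
- exists j.+1%:R, (-1); split; first by rewrite oppr_eq0 oner_eq0.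
  rewrite -natr1 addrK natr1 /edge_weight !Zp_nat /=.
  have j1 : (j.+1 < n.+2)%N by rewrite ltnS ltnW.
  rewrite (modn_small j1) (modn_small (ltnW j1)).
  by rewrite /edge /=; apply: colP2; rewrite !mxE /= ?mxE; ring.
- exists (0 : 'I_n.+2), (1 : R); split; first exact: oner_neq0.
  have -> : 0 - 1 = ord_max :> 'I_n.+2.
    by apply/val_inj; rewrite /= modn_small ?add0n ?modn_small// subSS subn0 modn_small.
  rewrite /edge_weight /edge /= rhoNN// rho0 X01.
  by apply: colP2; rewrite !mxE /= ?mxE; ring.
Qed.

Unset Implicit Arguments.
Theorem theorem4p1 (R : realType) (gamma : R -> R)
    (gamma_C1 : C1_on (- pi) pi gamma)
    (gamma_pos : {in `[- pi, pi], forall t, 0 < gamma t})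
    (gamma_per : gamma (- pi) = gamma pi)
    (N : nat) (N_ge3 : (3 <= N)%N)
    (tau : R) (tau_gt0 : 0 < tau)
    (X : R -> 'cV[R]_2) (X_in : Xph N X)
    (not_parallel : exists j1 j2 : nat,
       [/\ (1 <= j1)%N, (j1 < j2)%N, (j2 <= N.-1)%N
         & dot (tilde_edge N X j1) (perp (tilde_edge N X j2)) <> 0])
    (nondegenerate : forall j : nat, (1 <= j <= N)%N -> 0 < enorm (edge N X j))
    (theta : nat -> R) (theta_angle : is_edge_angle N X theta) :
  exists (Y : R -> 'cV[R]_2) (mu : R -> R),
    is_solution gamma N tau X theta Y mu /\
    forall (Y' : R -> 'cV[R]_2) (mu' : R -> R),
      is_solution gamma N tau X theta Y' mu' ->
      {in `[0, 1], Y' =1 Y} /\ {in `[0, 1], mu' =1 mu}.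
Proof.
case: N N_ge3 X_in not_parallel nondegenerate theta_angle => [|[|n]] // _.
move=> hX [j1 [j2 [j1_ge1 j12 j2_le par]]] nd ang.
have X01 := Xph_periodic hX.
have w_nodes : exists i1 i2 : 'I_n.+2,
    dot (edge_weight (n := n) X (i1 - 1) + edge_weight (n := n) X i1)
      (perp (edge_weight (n := n) X (i2 - 1) + edge_weight (n := n) X i2)) <> 0.
  have [|i1 [s1 [s1n0 e1]]] := @tilde_edge_weight R n X j1 X01.
    by rewrite j1_ge1 (leq_trans (ltnW j12)).
  have [|i2 [s2 [s2n0 e2]]] := @tilde_edge_weight R n X j2 X01.
    by rewrite j2_le (leq_trans j1_ge1 (ltnW j12)).
  exists i1, i2; rewrite e1 e2 => /eqP e; apply: par; apply/eqP.
  move: e; set p := tilde_edge _ _ _; set q := tilde_edge _ _ _.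
  have -> : dot (s1 *: perp p) (perp (s2 *: perp q)) = s1 * s2 * dot p (perp q).
    by rewrite !dotE !mxE /= ?mxE /=; ring.
  by rewrite !mulf_eq0 (negPf s1n0) (negPf s2n0).
have posA i (v : 'cV[R]_2) : v != 0 ->
    0 < dot (edge_matrix (n := n) gamma X theta i *m v) v.
  have [th _ _] := ang i.+1 (ltn_ord i).
  by apply: edge_matrix_posdef; [exact: (nd i.+1 (ltn_ord i))|apply: gamma_pos; rewrite in_itv].
have posk i : 0 < edge_conductance (n := n) X i.
  by rewrite invr_gt0; exact: (nd i.+1 (ltn_ord i)).
have tauV : 0 < tau^-1 by rewrite invr_gt0.
have inj := saddle_nondegenerate tauV posk posA w_nodes.
have lin1 := saddle_linear1 tau^-1 (edge_weight (n := n) X)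
  (edge_conductance (n := n) X) (edge_matrix (n := n) gamma X theta).
have lin2 := saddle_linear2 tau^-1 (edge_weight (n := n) X)
  (edge_conductance (n := n) X) (edge_matrix (n := n) gamma X theta).
pose F (Z : unknowns R n) := tau^-1 * mass (edge_weight (n := n) X) (nodal n X) Z.2.
have linF : linear_for *%R F.
  by move=> a Z Z'; rewrite /F /= mass_linear2; ring.
have [[Yn mun] sol] := nondegenerate_form_solvable lin1 lin2 linF inj.
exists (vinterp Yn), (interp mun).
have hY := vinterp_Xph Yn; have hmu := interp_Kph mun.
split.
  by apply/is_solution_nodal => // Z; rewrite nodal_vinterp nodal_interp.
move=> Y' mu' sol'; have [hY' hmu' _ _] := sol'.
have {}sol' := (is_solution_nodal gamma tau theta nd hX hY' hmu').1 sol'.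
have /eqP : (-1) *: (Yn, mun) + (nodal n Y', nodal n (mu' : R -> R^o)) = 0.
  by apply: inj => Z; rewrite lin1 sol sol' mulN1r addNr.
rewrite scaleN1r addrC subr_eq0 => /eqP[eY emu].
split.
- by apply: Xph_nodal_inj => //; rewrite nodal_vinterp.
- exact: Kph_nodal_inj hmu' hmu (etrans emu (esym (nodal_interp mun))).
Qed.
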